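(* Let $I$ be a finite set of integers, each at least $2$, containing no two consecutive integers (an admissible peak set), and let $m$ be an integer with $\max(I)\le m$ (with $m\ge 1$). Then for every integer $n>m$, \[ p(I,n)=b_0(I)\binom{n-m}{0}+b_1(I)\binom{n-m}{1}+\cdots+b_m(I)\binom{n-m}{m}, \] where $b_k(I)$ is the number of permutations $\sigma\in D(S_I,2m)$ such that \[ \{\sigma_1,\ldots,\sigma_m\}\cap[m+1,2m]=[m+1,m+k] \] and $\sigma$ does not admit an $i$-flip for any $i\in I$.
   Context: $\mathfrak{S}_n$ is the set of permutations $\sigma=\sigma_1\cdots\sigma_n$ of $[n]=\{1,\ldots,n\}$ in one-line notation; $[a,b]=\{a,a+1,\ldots,b\}$ (empty if $b<a$). The descent set is $\mathrm{Des}(\sigma)=\{i\in[n-1]:\sigma_i>\sigma_{i+1}\}$. For $S\subseteq[n-1]$, $D(S,n)$ is the set of $\sigma\in\mathfrak{S}_n$ with $\mathrm{Des}(\sigma)=S$. For $S\subseteq[n-1]$ put $\mathrm{Peak}(S)=\{i:1<i\le n-1,\ i\in S,\ i-1\notin S\}$, $\mathrm{Valley}(S)=\{i:1<i\le n-1,\ i\notin S,\ i-1\in S\}$, $\mathrm{Spike}(S)=\mathrm{Peak}(S)\cup\mathrm{Valley}(S)$, and $\mathrm{Peak}(\sigma)=\mathrm{Peak}(\mathrm{Des}(\sigma))$, $\mathrm{Spike}(\sigma)=\mathrm{Spike}(\mathrm{Des}(\sigma))$. For a set $I$, $P(I,n)$ is the set of $\sigma\in\mathfrak{S}_n$ with $\mathrm{Peak}(\sigma)=I$,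 and $p(I,n)=2^{-n+|I|+1}|P(I,n)|$. For an admissible set $I=\{i_1<\cdots<i_k\}$, $S_I$ is the unique set $S$ with $\mathrm{Spike}(S)=I$ in which the elements of $I$ alternate between peaks and valleys, the largest one $i_k$ is a valley, and $S$ has no elements $\ge i_k$; explicitly, with $i_0:=1$, $S_I=\bigcup_{t\text{ odd},\,1\le t\le k}[i_{k-t},\,i_{k-t+1}-1]$ (so $S_\varnothing=\varnothing$, $S_{\{2,4\}}=\{2,3\}$). Flip operation: for $\sigma\in\mathfrak{S}_n$ and $i\le n$, write $\{\sigma_1,\ldots,\sigma_i\}=\{a_1<a_2<\cdots<a_i\}$ and define $\mathrm{fl}_i(\sigma)\in\mathfrak{S}_n$ by $\mathrm{fl}_i(\sigma)_j=a_{i-t+1}$ if $j\le i$ and $\sigma_j=a_t$, and $\mathrm{fl}_i(\sigma)_j=\sigma_j$ for $j>i$. For $i\in\mathrm{Spike}(\sigma)$, $\sigma$ admits an $i^+$-flip if $\mathrm{Spike}(\mathrm{fl}_i(\sigma))=\mathrm{Spike}(\sigma)\setminus\{i\}$, admits an $i^-$-flip if $\mathrm{Spike}(\mathrm{fl}_{i-1}(\sigma))=\mathrm{Spike}(\sigma)\setminus\{i\}$, and admits an $i$-flip if it admits an $i^+$-flip or an $i^-$-flip. *)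

(* Defs.v *)
From HB Require Import structures.
From mathcomp Require Import all_boot all_order all_algebra all_fingroup.
From mathcomp Require Import finmap.

Set Implicit Arguments.
Unset Strict Implicit.
Unset Printing Implicit Defensive.

Import GRing.Theory.
Local Open Scope nat_scope.
Local Open Scope fset_scope.

(* Positions and values are 1-based, as in one-line notation, and live in
   [nat]; 'S_n itself permutes {0, ..., n-1}. *)

Definition intv (a b : nat) : {fset nat} := [fset x in iota a (b.+1 - a)].

Lemma in_intv a b x : (x \in intv a b) = (a <= x <= b).
Proof.
rewrite !inE mem_iota; case: (leqP a x) => //= le_ax.
case: (leqP a b.+1) => [le_ab|lt_ba]; first by rewrite subnKC.
rewrite (eqP (ltnW lt_ba)) addn0 [x < a]ltnNge le_ax /=.
by symmetry; apply/negbTE; rewrite -ltnNge; apply: leq_trans le_ax; apply: ltnW.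
Qed.

Definition oneline n (s : 'S_n) : seq nat := [seq (s j).+1 | j <- enum 'I_n].

(* s_i; meaningful for 1 <= i <= n *)
Definition letter n (s : 'S_n) (i : nat) : nat := nth 0 (oneline s) i.-1.

Definition Des n (s : 'S_n) : {fset nat} :=
  [fset i in intv 1 n.-1 | letter s i.+1 < letter s i].

Definition D (S : {fset nat}) (n : nat) : {set 'S_n} :=
  [set s : 'S_n | Des s == S].

Definition Peak (n : nat) (S : {fset nat}) : {fset nat} :=
  [fset i in intv 2 n.-1 | (i \in S) && (i.-1 \notin S)].

Definition Valley (n : nat) (S : {fset nat}) : {fset nat} :=
  [fset i in intv 2 n.-1 | (i \notin S) && (i.-1 \in S)].

Definition Spike (n : nat) (S : {fset nat}) : {fset nat} :=
  Peak n S `|` Valley n S.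

Definition perm_Peak n (s : 'S_n) : {fset nat} := Peak n (Des s).

Definition perm_Spike n (s : 'S_n) : {fset nat} := Spike n (Des s).

Definition P (I : {fset nat}) (n : nat) : {set 'S_n} :=
  [set s : 'S_n | perm_Peak s == I].

Definition p (I : {fset nat}) (n : nat) : rat :=
  ((2%:R : rat) ^ (- n%:Z + #|` I|%:Z + 1) * #|P I n|%:R)%R.

Definition admissible (I : {fset nat}) : Prop :=
  (forall i, i \in I -> 2 <= i) /\ (forall i, i \in I -> i.+1 \notin I).

(* i_j for I = {i_1 < ... < i_k}, with the convention i_0 = 1 *)
Definition elt (I : {fset nat}) (j : nat) : nat :=
  nth 0 (1 :: sort leq (enum_fset I)) j.

Definition S_ (I : {fset nat}) : {fset nat} :=
  \bigcup_(t <- iota 1 #|` I| | odd t)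
     intv (elt I (#|` I| - t)) (elt I (#|` I| - t + 1) - 1).

Section Flip.
Variables (n i : nat) (s : 'S_n).

(* a_1 < ... < a_i, increasing because [enum] follows the order of 'I_n *)
Definition prefix_values : seq 'I_n := enum [set s j | j : 'I_n & j < i].

(* a_{t+1} sits at index t of [prefix_values], whose size is i as soon as
   i <= n; a_{i-(t+1)+1} is therefore at index i - (t+1). *)
Definition flip_fun (j : 'I_n) : 'I_n :=
  if j < i then
    nth (s j) prefix_values
      (size prefix_values - (index (s j) prefix_values).+1)
  else s j.

Lemma mem_prefix_values j : (s j \in prefix_values) = (j < i).
Proof.
by rewrite mem_enum mem_imset ?inE //; apply: perm_inj.
Qed.

Lemma size_prefix_values : i <= n -> size prefix_values = i.
Proof.
move=> le_in; rewrite -cardE card_imset; last exact: perm_inj.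
rewrite -sum1_card (eq_bigl (fun j : 'I_n => j < i)); last by move=> j; rewrite inE.
by rewrite (big_ord_narrow le_in) sum1_card card_ord.
Qed.

Lemma flip_fun_inj : injective flip_fun.
Proof.
have rev_lt k : k < size prefix_values ->
    size prefix_values - k.+1 < size prefix_values.
  by move=> lt_k; rewrite -subSn // subSS leq_subr.
have mem_flip (j : 'I_n) : j < i -> flip_fun j \in prefix_values.
  move=> lt_ji; rewrite /flip_fun lt_ji mem_nth // rev_lt //.
  by rewrite index_mem mem_prefix_values.
have out_flip (j : 'I_n) : ~~ (j < i) -> flip_fun j \notin prefix_values.
  by move=> ge_ji; rewrite /flip_fun (negbTE ge_ji) mem_prefix_values.
move=> j k eq_jk; case: (boolP (j < i)) (boolP (k < i)) => [lt_j|ge_j] [lt_k|ge_k].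
- move: eq_jk; rewrite /flip_fun lt_j lt_k.
  have ltj : index (s j) prefix_values < size prefix_values.
    by rewrite index_mem mem_prefix_values.
  have ltk : index (s k) prefix_values < size prefix_values.
    by rewrite index_mem mem_prefix_values.
  rewrite (set_nth_default (s k)) ?rev_lt // => /eqP.
  rewrite nth_uniq ?enum_uniq ?rev_lt // => /eqP /(congr1 (subn (size prefix_values))).
  rewrite !subKn // => -[] eq_idx; apply: (@perm_inj _ s).
  by rewrite -(nth_index (s j) (s := prefix_values) (x := s j)) ?mem_prefix_values //
             eq_idx nth_index ?mem_prefix_values.
- by have := out_flip _ ge_k; rewrite -eq_jk mem_flip.
- by have := out_flip _ ge_j; rewrite eq_jk mem_flip.
- by move: eq_jk; rewrite /flip_fun (negbTE ge_j) (negbTE ge_k); apply: perm_inj.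
Qed.

Definition fl : 'S_n := perm flip_fun_inj.

End Flip.

Definition admits_plus_flip n (i : nat) (s : 'S_n) : bool :=
  perm_Spike (fl i s) == perm_Spike s `\ i.

Definition admits_minus_flip n (i : nat) (s : 'S_n) : bool :=
  perm_Spike (fl i.-1 s) == perm_Spike s `\ i.

(* Only used for i in perm_Spike s, as in the definition of flips. *)
Definition admits_flip n (i : nat) (s : 'S_n) : bool :=
  admits_plus_flip i s || admits_minus_flip i s.

Definition b (m : nat) (I : {fset nat}) (k : nat) : nat :=
  #|[set s in D (S_ I) (2 * m) |
      ([fset letter s j | j in intv 1 m] `&` intv m.+1 (2 * m)
         == intv m.+1 (m + k))
      && [forall i : I, ~~ admits_flip (val i) s]]|.

(* Main.v *)
Require Import Defs.
From mathcomp Require Import all_boot all_order all_algebra all_fingroup.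
From mathcomp Require Import finmap.
From mathcomp Require Import zify.

(* Let rk_j be the number of letters smaller than the j-th one among those
   before it (j counted from 0), and e_j = 2 rk_j - j. Descents of s are the
   descents of the sequence e, and flips change the signs of its entries, so
   |e| is invariant; in these terms i is unflippable iff |e| has a peak there.
   Among the sign choices for a sequence of absolute values d, those with
   descent set S number 2^(|Peak d| + 1) if Peak d is contained in Spike S, and
   none exist otherwise. Applied to d = |e| and, with signs attached to values,
   to d = s itself, this gives
     2^n |D(S,n)| = sum over s of [X(s) in Spike S] 2^(|X(s)| + 1)
   both for X = Peak(|e|) and for X = Peak. Moebius inversion over S = S_J,
   J in I, shows that the two statistics X are equidistributed, whence p(I,n)
   counts the unflippable permutations of D(S_I,n).
   These increase after position m, hence are determined by the set A of their
   first m values and its arrangement q; rk_m is the length of the initial run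
   of A, so being unflippable depends only on q and on the part of A below m.
   Choosing the k values above m freely yields the binomial coefficient. *)

Set Implicit Arguments.
Unset Strict Implicit.
Unset Printing Implicit Defensive.

Local Open Scope fset_scope.
Local Open Scope nat_scope.

(** * Ranks and flips *)

Lemma letterE n (s : 'S_n) (j : 'I_n) : letter s j.+1 = (s j).+1.
Proof.
by rewrite /letter /oneline /= (nth_map j) ?size_enum_ord // nth_ord_enum.
Qed.

Lemma letter_inj n (s : 'S_n) i j :
  i < n -> j < n -> letter s i.+1 = letter s j.+1 -> i = j.
Proof.
move=> lti ltj; rewrite -[i]/(val (Ordinal lti)) -[j]/(val (Ordinal ltj)) !letterE.
by case=> /val_inj /perm_inj ->.
Qed.

Lemma in_intv_sep (P : pred nat) a b i :
  (i \in [fset j in intv a b | P j]) = (a <= i <= b) && P i.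
Proof. by rewrite -in_intv !inE. Qed.

Lemma in_Des n (s : 'S_n) i :
  (i \in Des s) = [&& 0 < i, i < n & letter s i.+1 < letter s i].
Proof.
rewrite in_intv_sep.
by case: i n s => [|i] [|n] s.
Qed.

Lemma in_Peak n S i : (i \in Peak n S) = [&& 1 < i, i < n, i \in S & i.-1 \notin S].
Proof.
rewrite in_intv_sep -andbA.
by case: i n => [|i] [|n].
Qed.

Lemma in_Valley n S i : (i \in Valley n S) = [&& 1 < i, i < n, i \notin S & i.-1 \in S].
Proof.
rewrite in_intv_sep -andbA.
by case: i n => [|i] [|n].
Qed.

Lemma in_Spike n S i :
  (i \in Spike n S) = [&& 1 < i, i < n & (i \in S) != (i.-1 \in S)].
Proof.
rewrite in_fsetU in_Peak in_Valley.
by case: (1 < i) (i < n) (i \in S) (i.-1 \in S) => [] [] [] [].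
Qed.

(* Indexed from 0: position [j] carries [letter s j.+1]. *)
Definition rk n (s : 'S_n) (j : nat) : nat :=
  \sum_(0 <= k < j) (letter s k.+1 < letter s j.+1).

Lemma sum_nat_bool_le (P : pred nat) j : \sum_(0 <= k < j) P k <= j.
Proof.
by rewrite -[leqRHS]subn0 -[leqRHS]muln1 -sum_nat_const_nat leq_sum // => k _; case: (P k).
Qed.

Lemma rk_le n (s : 'S_n) j : rk s j <= j.
Proof. exact: sum_nat_bool_le. Qed.

(** If the later letter is larger, it exceeds the earlier letter and all that this one exceeds; if
    it is smaller, its rank cannot be larger. *)
Lemma rk_Des n (s : 'S_n) i : i.+1 < n -> (i.+1 \in Des s) = (rk s i.+1 <= rk s i).
Proof.
move=> lt_in; rewrite in_Des lt_in /= /rk big_nat_recr //=.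
case: ltngtP => [lt_l|lt_l|/letter_inj eq_l].
- rewrite addn0; symmetry; apply: leq_sum => k _.
  lia.
- apply/esym/negbTE; rewrite -ltnNge addn1 ltnS; apply: leq_sum => k _.
  lia.
- by have := eq_l lt_in (ltnW lt_in); lia.
Qed.

Lemma enum_sorted_ltn n (A : {set 'I_n}) : sorted (fun a b : 'I_n => a < b) (enum A).
Proof.
rewrite {1}/enum_mem sorted_filter //; first by move=> a b c; apply: ltn_trans.
by have := iota_ltn_sorted 0 n; rewrite -val_enum_ord sorted_map -enumT.
Qed.

Lemma enum_index_ltn n (A : {set 'I_n}) (x y : 'I_n) : x \in A -> y \in A ->
  (index x (enum A) < index y (enum A)) = (x < y).
Proof.
have tr : transitive (fun a b : 'I_n => a < b) by move=> a b c; apply: ltn_trans.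
have mono a b : a \in A -> b \in A -> index a (enum A) < index b (enum A) -> a < b.
  move=> aA bA lt_ab.
  have:= sorted_ltn_nth tr a (enum_sorted_ltn A) (index a (enum A)) (index b (enum A)).
  by rewrite !inE !index_mem !mem_enum !nth_index ?mem_enum // => ->.
move=> xA yA; case: (ltnP x y) => [lt_xy|le_yx]; last first.
  by apply/negbTE/negP => /(mono _ _ xA yA); rewrite ltnNge le_yx.
case: ltngtP => // [/(mono _ _ yA xA)|eq_i]; first by lia.
by move: lt_xy; rewrite -(nth_index x (s := enum A) (x := x)) ?mem_enum // eq_i nth_index ?mem_enum ?ltnn.
Qed.

Lemma enum_nth_ltn n (A : {set 'I_n}) (x y : 'I_n) a b : a < #|A| -> b < #|A| ->
  (nth x (enum A) a < nth y (enum A) b) = (a < b).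
Proof.
move=> lt_a lt_b; rewrite (set_nth_default x y) -?cardE //.
rewrite -(@enum_index_ltn _ A); try by rewrite -mem_enum mem_nth -?cardE.
by rewrite !index_uniq ?enum_uniq -?cardE.
Qed.

Section Flip.
Variables (n i : nat).
Hypothesis le_in : i <= n.
Implicit Types s : 'S_n.

(** For an increasing list of values, this is the order-reversing involution of its entries. *)
Let flip_val (p : seq 'I_n) (x : 'I_n) : 'I_n := nth x p (size p - (index x p).+1).

Lemma fl_lt s (j : 'I_n) : j < i -> fl i s j = flip_val (prefix_values i s) (s j).
Proof. by move=> lt_ji; rewrite permE /flip_fun lt_ji. Qed.

Lemma fl_ge s (j : 'I_n) : i <= j -> fl i s j = s j.
Proof. by move=> le_ij; rewrite permE /flip_fun ltnNge le_ij. Qed.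

Lemma flip_val_mem (p : seq 'I_n) x : x \in p -> flip_val p x \in p.
Proof.
by move=> px; rewrite mem_nth // -subSn ?subSS ?leq_subr // index_mem.
Qed.

Lemma flip_valK (p : seq 'I_n) : uniq p -> {in p, cancel (flip_val p) (flip_val p)}.
Proof.
move=> Up x px; have ltx: index x p < size p by rewrite index_mem.
rewrite {1}/flip_val /flip_val.
have rev_lt k m : k < m -> m - k.+1 < m by lia.
have rev_rev k m : k < m -> m - (m - k.+1).+1 = k by lia.
by rewrite index_uniq ?rev_lt // rev_rev // nth_index.
Qed.

Lemma fl_prefix s : [set fl i s j | j : 'I_n & j < i] = [set s j | j : 'I_n & j < i].
Proof.
apply/eqP; rewrite eqEcard !card_imset ?leqnn ?andbT; try exact: perm_inj.
apply/subsetP => x /imsetP[j]; rewrite inE => lt_ji ->.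
by rewrite fl_lt // -mem_enum flip_val_mem // mem_prefix_values.
Qed.

Lemma prefix_values_fl s : prefix_values i (fl i s) = prefix_values i s.
Proof. by rewrite /prefix_values fl_prefix. Qed.

Lemma flK : involutive (@fl n i).
Proof.
move=> s; apply/permP => j; case: (ltnP j i) => [lt_ji|le_ij]; last by rewrite !fl_ge.
rewrite fl_lt // prefix_values_fl fl_lt // flip_valK ?enum_uniq //.
by rewrite mem_prefix_values.
Qed.

Lemma fl_ltn s (j k : 'I_n) : j < i -> k < i -> (fl i s j < fl i s k) = (s k < s j).
Proof.
move=> lt_ji lt_ki; pose p := prefix_values i s; have Up : uniq p by exact: enum_uniq.
have sp (l : 'I_n) : l < i -> s l \in p by rewrite mem_prefix_values.
have ltp (l : 'I_n) : l < i -> index (s l) p < size p by move/sp; rewrite index_mem.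
have fp (l : 'I_n) : l < i -> index (fl i s l) p = size p - (index (s l) p).+1.
  move=> lt_li; rewrite fl_lt // index_uniq // -/p.
  by rewrite -subSn ?ltp // subSS leq_subr.
rewrite -(@enum_index_ltn _ [set s j | j : 'I_n & j < i]); try by rewrite -fl_prefix imset_f ?inE.
rewrite -(@enum_index_ltn _ [set s j | j : 'I_n & j < i]); try by rewrite imset_f ?inE.
have rev_ltn a b c : a < c -> b < c -> (c - a.+1 < c - b.+1) = (b < a) by lia.
by rewrite -[enum _]/p !fp // rev_ltn ?ltp.
Qed.

(** Among the first [i] positions all comparisons are reversed; a later letter is compared with the
    same set of prefix values. Thus e_j changes sign for [j < i] and is kept otherwise. *)
Lemma rk_fl s j : j < n -> rk (fl i s) j = if j < i then j - rk s j else rk s j.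
Proof.
move=> lt_jn; pose oj := Ordinal lt_jn; rewrite /rk; case: (ltnP j i) => [lt_ji|le_ij].
  rewrite -[X in X - _]subn0 -[X in X - _]muln1 -sum_nat_const_nat -sumnB; last by move=> k _; case: ltnP.
  rewrite [LHS]big_nat [RHS]big_nat; apply: eq_bigr => k /= lt_kj.
  have lt_kn: k < n by lia.
  have -> : letter (fl i s) k.+1 < letter (fl i s) j.+1 = (letter s j.+1 < letter s k.+1).
    by rewrite -[k]/(val (Ordinal lt_kn)) -[j]/(val oj) !letterE !ltnS fl_ltn //=; lia.
  have: letter s j.+1 != letter s k.+1 by apply/eqP => /letter_inj; lia.
  by case: ltngtP.
have lE k : i <= k -> k < n -> letter (fl i s) k.+1 = letter s k.+1.
  by move=> le_ik lt_kn; rewrite -[k]/(val (Ordinal lt_kn)) !letterE fl_ge.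
rewrite (big_cat_nat _ le_ij) //= [RHS](big_cat_nat _ le_ij) //=; congr (_ + _); last first.
  by rewrite big_nat [RHS]big_nat; apply: eq_bigr => k /= lt_kj; rewrite !lE //; lia.
rewrite lE //; move: (letter s j.+1) => x.
have prefE (t : 'S_n) : \sum_(0 <= k < i) (letter t k.+1 < x)
    = \sum_(a in [set t l | l : 'I_n & l < i]) (a.+1 < x).
  rewrite big_imset; last by move=> ? ? _ _; apply: perm_inj.
  rewrite big_mkord (big_ord_widen n (fun k => letter t k.+1 < x : nat)) //.
  by apply: eq_big => [k|k _]; rewrite ?inE ?letterE.
by rewrite !prefE fl_prefix.
Qed.

End Flip.

(** The flips of lengths [k] and [k.+1] together negate only e_k, so any choice of signs is realized
    position by position. *)
Lemma sign_action n (eta : nat -> bool) :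
  exists2 f : 'S_n -> 'S_n, injective f &
    forall s j, j < n -> rk (f s) j = if eta j then j - rk s j else rk s j.
Proof.
suff flips k : k <= n -> exists2 f : 'S_n -> 'S_n, injective f &
    forall s j, j < n -> rk (f s) j = if (j < k) && eta j then j - rk s j else rk s j.
  by have [f injf fP] := flips _ (leqnn n); exists f => // s j lt_jn; rewrite fP // lt_jn.
elim: k => [|k IHk] lt_kn; first by exists id.
have [f injf fP] := IHk (ltnW lt_kn); case: (boolP (eta k)) => eta_k; last first.
  exists f => // s j lt_jn; rewrite fP // ltnS.
  by case: ltngtP => // ->; rewrite (negbTE eta_k).
exists (fun s => fl k.+1 (fl k (f s))) => [s t /(can_inj (flK lt_kn))|s j lt_jn].
  by move/(can_inj (flK (ltnW lt_kn)))/injf.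
rewrite rk_fl // rk_fl ?(ltnW lt_kn) // fP //.
have := rk_le s j; rewrite ltnS.
case: ltngtP => [_|_|->] //=; last by rewrite eta_k.
by case: (eta j) => // le_rj; rewrite subKn // leq_subr.
Qed.

(** * Sign choices with a given descent set *)

Definition pk (n : nat) (d : nat -> nat) : {fset nat} :=
  [fset i in intv 2 n.-1 | (d i.-2 < d i.-1) && (d i < d i.-1)].

Lemma in_pk n d i :
  (i \in pk n d) = [&& 1 < i, i < n, d i.-2 < d i.-1 & d i < d i.-1].
Proof.
rewrite in_intv_sep -andbA.
by case: i n => [|i] [|n].
Qed.

Lemma card_fset_bounded (A : {fset nat}) n : (forall i, i \in A -> i < n) ->
  #|` A| = \sum_(0 <= i < n) (i \in A).
Proof.
move=> ltA; rewrite -big_mkcond /= sum1_count -size_filter.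
apply: perm_size; apply: uniq_perm; rewrite ?filter_uniq ?iota_uniq ?fset_uniq // => i.
by rewrite mem_filter mem_index_iota /=; case: (boolP (i \in A)) => //= /ltA.
Qed.

(** Rises and falls of a boolean sequence alternate. This serves to compare the numbers of local
    minima and maxima. *)
Lemma sum_shift_telescope (a : nat -> bool) n :
  \sum_(0 <= j < n) (~~ a j && a j.+1) + a 0 =
  \sum_(0 <= j < n) (a j && ~~ a j.+1) + a n.
Proof.
elim: n => [|n IHn]; first by rewrite !big_geq.
by rewrite !big_nat_recr //=; case: (a n) (a n.+1) (a 0) IHn => [] [] []; lia.
Qed.

(* Whether the sequence with absolute values [d] and negative entries where
   [neg] holds descends from position [i.-1] to [i]. *)
Definition sdes (d : nat -> nat) (neg : nat -> bool) (i : nat) : bool :=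
  if d i < d i.-1 then ~~ neg i.-1 else neg i.

Definition signs n (eta : {ffun 'I_n -> bool}) (j : nat) : bool :=
  oapp eta false (insub j).

Lemma signsE n (eta : {ffun 'I_n -> bool}) (j : 'I_n) : signs eta j = eta j.
Proof. by rewrite /signs valK. Qed.

Lemma card_bool_pred (F : pred bool) : #|F| = F true + F false.
Proof. by rewrite -sum1_card big_mkcond big_bool. Qed.

(* Each position is constrained by its smaller neighbours only: a local maximum
   twice, a local minimum never, any other position once. *)
Lemma card_signs n (d : nat -> nat) (t : nat -> bool) (S : {fset nat}) :
  0 < n -> (forall i, i.+1 < n -> d i <> d i.+1) ->
  #|[set eta : {ffun 'I_n -> bool} |
      [forall i : 'I_n, (0 < i) ==>
         (sdes d (fun j => signs eta j (+) t j) i == (val i \in S))]]| =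
  if pk n d `<=` Spike n S then 2 ^ (#|` pk n d|).+1 else 0.
Proof.
move=> n_gt0 dneq.
(* The sign at [j] decides the comparison with each smaller neighbour, so the conditions split into
   independent ones for each position. *)
pose F (j : 'I_n) : pred bool := fun e =>
  ((0 < j) && (d j.-1 < d j) ==> (e (+) t j == (val j \in S))) &&
  ((j.+1 < n) && (d j.+1 < d j) ==> (e (+) t j == (j.+1 \notin S))).
have -> : #|[set eta : {ffun 'I_n -> bool} |
      [forall i : 'I_n, (0 < i) ==>
         (sdes d (fun j => signs eta j (+) t j) i == (val i \in S))]]| = #|family F|.
  apply: eq_card => eta; rewrite inE; apply/forallP/familyP => [etaP j|etaF i].
    rewrite /in_mem /= /F; apply/andP; split; apply/implyP => /andP[lt_j lt_d].
      have := etaP j; rewrite lt_j /= /sdes ltnNge ltnW //= signsE //.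
    have := etaP (Ordinal lt_j); rewrite /= /sdes lt_d signsE.
    by case: (_ (+) _); case: (_ \in S).
  apply/implyP => lt_i; rewrite /sdes; case: (ltnP (d i)) => lt_d.
    have lt_i1 : i.-1 < n by have := ltn_ord i; lia.
    have := etaF (Ordinal lt_i1) => /andP[_] /=; rewrite prednK // ltn_ord lt_d /=.
    by rewrite -signsE /=; case: (_ (+) _); case: (_ \in S).
  have lt_d' : d i.-1 < d i.
    have := @dneq i.-1; rewrite prednK // ltn_ord => /(_ isT); move: lt_d; lia.
  by have := etaF i => /andP[]; rewrite lt_i lt_d' /= signsE.
rewrite card_family foldrE big_map big_enum /=.
(* Position [j] exceeds its left neighbour. The values at [0] and [n] make both ends behave as if no
   smaller neighbour lay beyond them. *)
pose a j := (j == n) || ((0 < j) && (d j.-1 < d j)).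
have aE j : 0 < j < n -> a j = (d j.-1 < d j).
  by case/andP=> lt0j lt_jn; rewrite /a lt0j (ltn_eqF lt_jn).
have aN j : j.+1 < n -> ~~ a j.+1 = (d j.+1 < d j).
  by move=> lt_jn; rewrite aE //=; have := @dneq j lt_jn; lia.
have a0 : a 0 = false by rewrite /a; case: n n_gt0 {dneq F aE aN a}.
have an : a n by rewrite /a eqxx.
have pkE j : j < n -> (j.+1 \in pk n d) = a j && ~~ a j.+1.
  move=> lt_jn; rewrite in_pk; case: j lt_jn => [|j] lt_jn; first by rewrite a0.
  rewrite aE //=; case: (ltnP j.+2 n) => [lt2|le2]; first by rewrite aN.
  by rewrite (_ : j.+2 = n) ?an ?andbF //; lia.
have FE (j : 'I_n) : F j =1 fun e =>
    (a j ==> (e (+) t j == (val j \in S))) &&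
    (~~ a j.+1 ==> (e (+) t j == (j.+1 \notin S))).
  move=> e; rewrite /F; congr ((_ ==> _) && (_ ==> _)).
    by rewrite /a (ltn_eqF (ltn_ord j)).
  case: (ltnP j.+1 n) => [lt_j|le_j]; first by rewrite aN.
  by rewrite (_ : j.+1 = n) ?an //; have := ltn_ord j; lia.
(* Two signs are allowed at a local minimum and one elsewhere, except that the two constraints at a
   local maximum clash unless it is a spike of [S]. *)
have cardF (j : 'I_n) : #|F j| =
    if (j.+1 \in pk n d) && (j.+1 \notin Spike n S) then 0 else 2 ^ (~~ a j && a j.+1).
  have : a j && ~~ a j.+1 -> 1 < j.+1 < n.
    by rewrite -pkE // in_pk andbA => /andP[].
  rewrite card_bool_pred !FE pkE // in_Spike andbA /=.
  by case: (a j) (a j.+1) (t j) (_ \in S) (_ \in S) => [] [] [] [] [] //= ->.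
under eq_bigr do rewrite cardF.
case: ifP => [/fsubsetP sub|/negbT nsub].
  under eq_bigr => j _.
    rewrite (_ : _ && _ = false); last by apply/negP => /andP[/sub ->].
    over.
  rewrite -expn_sum; congr (_ ^ _).
  (* Minima at the ends count and maxima at the ends do not, so the minima exceed the peaks by
     one. *)
  have := sum_shift_telescope a n; rewrite a0 an addn0 addn1 big_mkord => ->.
  congr (_.+1); rewrite (@card_fset_bounded _ n.+1); last first.
    by move=> i; rewrite in_pk => /and4P[_ /ltnW].
  rewrite big_nat_recl // (_ : (0 \in pk n d) = false) ?in_pk // add0n.
  by rewrite big_nat [RHS]big_nat; apply: eq_bigr => j /= lt_jn; rewrite pkE.
case/fsubsetPn: nsub => i i_pk i_S; move: (i_pk); rewrite in_pk => /and4P[lt1i lt_in _ _].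
have lt_i1 : i.-1 < n by lia.
rewrite (bigD1 (Ordinal lt_i1)) //= prednK ?i_pk ?i_S //; lia.
Qed.

(** * Two expansions of the number of permutations with a given descent set *)

(* With e_j = 2 rk_j - j, position [j] is a descent iff e_(j-1) > e_j, and
   flips act on e by changing signs; [absrk] is the invariant |e_j|. *)
Definition absrk n (s : 'S_n) (j : nat) : nat :=
  (2 * rk s j - j) + (j - 2 * rk s j).

Definition absrk_pk n (s : 'S_n) : {fset nat} := pk n (absrk s).

(** e_i and e_(i+1) have opposite parities. *)
Lemma absrk_neq n (s : 'S_n) i : absrk s i <> absrk s i.+1.
Proof. by rewrite /absrk; lia. Qed.

Lemma Des_eqE n (s : 'S_n) (S : {fset nat}) : (forall i, i \in S -> 0 < i < n) ->
  (Des s == S) = [forall i : 'I_n, (0 < i) ==> ((val i \in Des s) == (val i \in S))].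
Proof.
move=> ltS; apply/eqP/forallP => [-> i|eqS]; first by rewrite eqxx implybT.
apply/fsetP => i; case: (ltnP 0 i) => [lt0i|le0i]; last first.
  by rewrite in_Des ltnNge le0i; apply/esym/negP => /ltS; lia.
case: (ltnP i n) => [ltin|lein]; first by apply/eqP; have:= eqS (Ordinal ltin); rewrite lt0i.
by rewrite in_Des [i < n]ltnNge lein andbF; apply/esym/negP => /ltS; lia.
Qed.

(** [2 * rk s j < j] is the original sign of e_j, toggled by [eta j]. The sign of a zero entry is
    never read, as [sdes] consults the entry of larger absolute value. *)
Lemma sign_action_Des n (eta : nat -> bool) (s s' : 'S_n) i : i.+1 < n ->
  (forall j, j < n -> rk s' j = if eta j then j - rk s j else rk s j) ->
  (i.+1 \in Des s') =
    sdes (absrk s) (fun j => eta j (+) (2 * rk s j < j)) i.+1.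
Proof.
move=> lt_in rkE; rewrite rk_Des // !rkE //; last exact: ltnW.
have := rk_le s i; have := rk_le s i.+1; rewrite /sdes /absrk /=.
by case: (eta i); case: (eta i.+1); case: ltnP => ? ? ?; rewrite ?addTb ?addFb; lia.
Qed.

Lemma sign_action_absrk n (eta : nat -> bool) (s s' : 'S_n) :
  (forall j, j < n -> rk s' j = if eta j then j - rk s j else rk s j) ->
  absrk_pk s' = absrk_pk s.
Proof.
move=> rkE; have absE j : j < n -> absrk s' j = absrk s j.
  by move=> lt_jn; rewrite /absrk rkE //; case: (eta j); have := rk_le s j; lia.
apply/fsetP => i; rewrite !in_pk.
case: (ltnP 1 i) => //= lt1i; case: (ltnP i n) => //= ltin.
by rewrite !absE //; lia.
Qed.

Lemma pk_letter n (s : 'S_n) : pk n (fun j => letter s j.+1) = perm_Peak s.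
Proof.
apply/fsetP => i; rewrite in_pk in_Peak !in_Des; case: i => [|[|i]] //=.
case: (ltnP i.+2 n) => //= ltin; rewrite (ltnW ltin) /= andbC -leqNgt; congr (_ && _).
by case: ltngtP => // /letter_inj; lia.
Qed.

Lemma card_signs_type n : #|{: {ffun 'I_n -> bool}}| = 2 ^ n.
Proof. by rewrite card_ffun card_bool card_ord. Qed.

Lemma card_set_sum (T : finType) (Q : pred T) : #|[set x | Q x]| = \sum_(x : T) Q x.
Proof. by rewrite -sum1_card big_mkcond; apply: eq_bigr => x _; rewrite inE; case: (Q x). Qed.

(** Double counting of pairs of a permutation and a sign vector: for fixed [s] the good vectors are
    counted by [card_signs]; for fixed [eta] the action is a bijection preserving [absrk_pk]. *)
Lemma card_Des_absrk_pk n (S : {fset nat}) (Q : pred {fset nat}) : 0 < n ->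
  (forall i, i \in S -> 0 < i < n) ->
  2 ^ n * #|[set s : 'S_n | (Des s == S) && Q (absrk_pk s)]| =
  \sum_(s : 'S_n | Q (absrk_pk s))
     (if absrk_pk s `<=` Spike n S then 2 ^ (#|` absrk_pk s|).+1 else 0).
Proof.
move=> n_gt0 ltS.
under [RHS]eq_bigr => s _.
  rewrite -(@card_signs n (absrk s) (fun j => 2 * rk s j < j) S n_gt0); last first.
    by move=> i _; apply: absrk_neq.
  rewrite card_set_sum; over.
rewrite exchange_big /= -card_signs_type -sum_nat_const; apply: eq_bigr => eta _.
have [f injf fP] := sign_action n (signs eta).
rewrite card_set_sum (reindex_inj injf) [RHS]big_mkcond; apply: eq_bigr => s _.
rewrite (sign_action_absrk (fP s)); case: (Q _); rewrite ?andbF // andbT.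
congr nat_of_bool; rewrite Des_eqE //; apply: eq_forallb => i.
case: (posnP i) => //= lt0i; congr (_ == _).
rewrite -[val i](prednK lt0i); apply: sign_action_Des; last exact: fP.
by rewrite (prednK lt0i).
Qed.

(** The permutation sends [x] to the number of [y] with [g y < g x]. *)
Lemma exists_standardization n (g : 'I_n -> nat) : injective g ->
  exists t : 'S_n, forall x y, (t x < t y) = (g x < g y).
Proof.
move=> injg; have ltr x : #|[set y | g y < g x]| < n.
  rewrite -[ltnRHS](card_ord n) -cardsT; apply: proper_card; rewrite properE subsetT /=.
  by apply/subsetPn; exists x; rewrite !inE ?ltnn.
have mono x y : g x < g y -> #|[set z | g z < g x]| < #|[set z | g z < g y]|.
  move=> lt_xy; apply: proper_card; apply/properP; split.
    by apply/subsetP => z; rewrite !inE => /ltn_trans->.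
  by exists x; rewrite !inE ?ltnn.
have injr : injective (fun x => Ordinal (ltr x)).
  move=> x y /(congr1 val) /= eq_r.
  by case: (ltngtP (g x) (g y)) => [/mono|/mono|/injg //]; rewrite eq_r ltnn.
exists (perm injr) => x y; rewrite !permE /=.
case: (ltngtP (g x) (g y)) => [/mono//|/mono|/injg->]; last by rewrite ltnn.
by move=> /ltnW le_r; rewrite ltnNge le_r.
Qed.

(** The same double counting with signs attached to values: for fixed signs, all signed words are
    standardized by one relabelling of the values. *)
Lemma card_Des_Peak n (S : {fset nat}) : 0 < n ->
  (forall i, i \in S -> 0 < i < n) ->
  2 ^ n * #|[set s : 'S_n | Des s == S]| =
  \sum_(s : 'S_n)
     (if perm_Peak s `<=` Spike n S then 2 ^ (#|` perm_Peak s|).+1 else 0).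
Proof.
move=> n_gt0 ltS.
under [RHS]eq_bigr => s _.
  rewrite -pk_letter -(@card_signs n _ (fun=> false) S n_gt0); last first.
    by move=> i lti /letter_inj; lia.
  (* Signs move from positions to values, so that the relabelling below does not depend on [s]. *)
  rewrite card_set_sum (reindex_inj (h := fun eta : {ffun 'I_n -> bool} => [ffun j => eta (s j)])) /=; last first.
    move=> eta eta' /ffunP eqe; apply/ffunP => x.
    by have := eqe (s^-1%g x); rewrite !ffunE permKV.
  over.
rewrite exchange_big /= -card_signs_type -sum_nat_const; apply: eq_bigr => eta _.
(* The signed value with absolute value [x.+1], shifted by [n] to stay in [nat]. *)
pose g (x : 'I_n) := if eta x then n - x.+1 else n + x.+1.
have injg : injective g.
  move=> x y; rewrite /g => eq_g; apply: ord_inj; move: eq_g.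
  by case: (eta x) (eta y) => [] []; have := ltn_ord x; have := ltn_ord y; lia.
have [t tP] := exists_standardization injg.
rewrite card_set_sum (reindex_inj (mulIg t)); apply: eq_bigr => s _.
congr nat_of_bool; rewrite Des_eqE //; apply: eq_forallb => i.
case: (posnP i) => //= lt0i; congr (_ == _).
have lt_i1 : i.-1 < n by have := ltn_ord i; lia.
pose i1 := Ordinal lt_i1; have lE (u : 'S_n) : letter u i = (u i1).+1.
  by rewrite -letterE /= prednK.
rewrite /sdes !addbF prednK // -[i.-1]/(val i1) !signsE !ffunE in_Des lt0i ltn_ord /=.
rewrite !letterE !lE !ltnS !permM tP /g.
have neq_s : s i != s i1 :> nat.
  by apply/eqP => /val_inj/perm_inj/(congr1 val) /=; lia.
move: (nat_of_ord (s i)) (nat_of_ord (s i1)) (ltn_ord (s i)) (ltn_ord (s i1)) neq_s => x y.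
by case: (eta (s i)); case: (eta (s i1)); case: ifP; lia.
Qed.

(** * Unflippable permutations *)

Lemma sum_fsubset (T : finType) (f : T -> {fset nat}) (w : {fset nat} -> nat) J :
  \sum_x (if f x `<=` J then w (f x) else 0) =
  \sum_(K <- fpowerset J) #|[set x | f x == K]| * w K.
Proof.
under [RHS]eq_bigr => K _ do rewrite card_set_sum big_distrl /=.
rewrite exchange_big; apply: eq_bigr => x _ /=; case: ifP => [sub|nsub].
  rewrite (bigD1_seq (f x)) ?fset_uniq ?fpowersetE //= eqxx mul1n big1 ?addn0 // => K.
  by rewrite eq_sym => /negbTE->.
rewrite big_seq big1 // => K; rewrite fpowersetE => sub.
by case: eqP nsub => // ->; rewrite sub.
Qed.

(** Moebius inversion over subsets: by induction all terms with [K] properly inside [I] agree, and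
    the remaining one is divided by [w I]. *)
Lemma eq_card_of_eq_fsubset_sums (T : finType) (f g : T -> {fset nat})
    (w : {fset nat} -> nat) (I : {fset nat}) :
  (forall K, 0 < w K) ->
  (forall J, J `<=` I -> \sum_x (if f x `<=` J then w (f x) else 0) =
                         \sum_x (if g x `<=` J then w (g x) else 0)) ->
  #|[set x | f x == I]| = #|[set x | g x == I]|.
Proof.
move=> w_gt0; have [k] := ubnP #|` I|; elim: k I => // k IHk I lt_Ik eq_sum.
have:= eq_sum I (fsubset_refl I); rewrite !sum_fsubset.
rewrite (bigD1_seq I) ?fset_uniq ?fpowersetE //= [RHS](bigD1_seq I) ?fset_uniq ?fpowersetE //=.
rewrite big_seq_cond [in RHS]big_seq_cond.
rewrite (eq_bigr (fun K => #|[set x | g x == K]| * w K)); last first.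
  move=> K /andP[]; rewrite fpowersetE => subK neK; congr (_ * _).
  have prK : K `<` I by rewrite fproperEneq neK.
  apply: IHk => [|J subJ]; last exact: eq_sum (fsubset_trans subJ subK).
  by rewrite -ltnS (leq_trans _ lt_Ik) // ltnS fproper_ltn_card.
by move/addIn/eqP; rewrite eqn_pmul2r // => /eqP.
Qed.

(** * Parity description of [S_ I] and its spikes *)

(** In a sorted list the entries above [i] form a suffix. *)
Lemma sorted_nth_gt u i p : sorted leq u -> p < size u ->
  (i < nth 0 u p) = (size u - count (fun x => i < x) u <= p).
Proof.
elim: u p => // x u IHu p /= path_u lt_p.
have /allP ge_x : all (leq x) u by apply: order_path_min path_u; apply: leq_trans.
have le_c := count_size (fun x => i < x) u.
case: (ltnP i x) => [lt_ix|le_xi].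
  have -> : count (fun y => i < y) u = size u.
    by apply/eqP; rewrite -all_count; apply/allP => y /ge_x /=; lia.
  rewrite add1n subnn leq0n; case: p lt_p => //= p lt_p.
  by apply: leq_trans lt_ix _; apply: ge_x; rewrite mem_nth.
case: p lt_p => [|p] lt_p /=; first by rewrite ltnNge le_xi; lia.
by rewrite IHu // ?(path_sorted path_u) //; lia.
Qed.

(** The interval with index [t] consists of the positive integers with exactly [t] elements of [I]
    above them, and only odd [t] are taken. *)
Lemma in_S_ (I : {fset nat}) (i : nat) : (forall x : nat, x \in I -> 1 < x) ->
  (i \in S_ I) = (0 < i) && odd (count (fun x => i < x) (enum_fset I)).
Proof.
move=> gt1; pose u := sort leq (enum_fset I).
have srt : sorted leq u by apply: sort_sorted; apply: leq_total.
have szu : size u = #|` I| by rewrite size_sort.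
have u_gt1 p : p < size u -> 1 < nth 0 u p.
  by move=> lt_p; apply: gt1; have := mem_nth 0 lt_p; rewrite mem_sort.
rewrite -(count_sort leq) -/u.
have le_c := count_size (fun x => i < x) u; rewrite szu in le_c.
have nth_gt p : p < size u -> (i < nth 0 u p) = (size u - count (fun x => i < x) u <= p).
  exact: sorted_nth_gt.
set c := count _ _ in le_c nth_gt *; clearbody c.
have intvE t : 0 < t <= #|` I| ->
    (i \in intv (elt I (#|` I| - t)) (elt I (#|` I| - t + 1) - 1)) = (0 < i) && (t == c).
  case/andP=> t_gt0 le_t; rewrite in_intv /elt addn1 /=.
  have lt_p : #|` I| - t < size u by rewrite szu; lia.
  have := u_gt1 _ lt_p => gt1_p.
  have -> : (i <= nth 0 u (#|` I| - t) - 1) = (i < nth 0 u (#|` I| - t)) by lia.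
  rewrite nth_gt // szu.
  case def_p: (#|` I| - t) => [|p] /=; first by move: (#|` I|) le_t le_c def_p => k; lia.
  have lt_p' : p < size u by rewrite szu; lia.
  have := u_gt1 _ lt_p'; have := nth_gt _ lt_p'; rewrite -/u szu.
  by move: (nth 0 u p) (#|` I|) le_t le_c def_p => z k; lia.
apply/bigfcupP/andP => [[t]|[i_gt0 odd_c]].
  rewrite mem_iota => /andP[le_t odd_t]; rewrite intvE; last by lia.
  by case/andP => -> /eqP <-.
have c_gt0 : 0 < c by rewrite lt0n; apply: contraTneq odd_c => ->.
exists c; first by rewrite mem_iota odd_c; lia.
by rewrite intvE ?i_gt0 ?eqxx // c_gt0.
Qed.

Lemma S_lt (I : {fset nat}) (m i : nat) : (forall x : nat, x \in I -> 1 < x <= m) ->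
  i \in S_ I -> 0 < i < m.
Proof.
move=> bndI; rewrite in_S_ => [/andP[-> odd_c]|x /bndI /andP[]//].
have : has (fun x => i < x) (enum_fset I) by rewrite has_count; case: count odd_c.
by case/hasP => x /bndI /andP[_ le_xm] /leq_trans->.
Qed.

(** Going from [i] to [i.-1] adds an element above exactly when [i] is in [I], so the parity changes
    exactly there. *)
Lemma Spike_S_ (I : {fset nat}) n : (forall x : nat, x \in I -> 1 < x < n) ->
  Spike n (S_ I) = I.
Proof.
move=> bndI; have gt1 x : x \in I -> 1 < x by case/bndI/andP.
apply/fsetP => i; rewrite in_Spike !in_S_ //.
case: (boolP (1 < i < n)) => [/andP[lt1i ltin]|nbnd]; last first.
  by rewrite andbA (negbTE nbnd) /=; apply/esym/negP => /bndI; rewrite (negbTE nbnd).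
have -> : count (fun x => i.-1 < x) (enum_fset I) =
    count (fun x => i < x) (enum_fset I) + (i \in I).
  rewrite -(count_uniq_mem i (fset_uniq I)) -[RHS]count_predUI.
  rewrite [X in _ + X](eq_count (a2 := pred0)) ?count_pred0 ?addn0.
    by apply: eq_count => x /=; lia.
  by move=> x /=; lia.
by rewrite lt1i ltin oddD; case: (i \in I); have := lt1i; case: (odd _); lia.
Qed.

(** * Effect of a flip on descents and spikes *)

(** Two sign changes reverse a comparison. At the border [x = k] only the earlier entry changes
    sign, which matters exactly when it has the larger absolute value. *)
Lemma Des_fl n (s : 'S_n) k x : k <= n -> 0 < x < n ->
  (x \in Des (fl k s)) =
  (x \in Des s) (+) ((x < k) || (x == k) && ~~ (absrk s x.-1 < absrk s x)).
Proof.
case: x => // x le_kn /= ltxn; rewrite !rk_Des // !rk_fl // ?(ltnW ltxn) //= /absrk.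
have := rk_le s x; have := rk_le s x.+1.
by case: (ltngtP x.+1 k) => /=; case: (ltnP x k) => /=; case: ltnP => /=; lia.
Qed.

(** The toggled descents form an initial interval, so spikes change only just past its end, at [k]
    or [k.+1]. *)
Lemma in_perm_Spike_fl n (s : 'S_n) k x : k <= n -> 1 < x < n ->
  (x \in perm_Spike (fl k s)) = (x \in perm_Spike s) (+)
   ((x == k) && (absrk s k.-1 < absrk s k) || (x == k.+1) && ~~ (absrk s k.-1 < absrk s k)).
Proof.
move=> le_kn /andP[lt1x ltxn]; rewrite /perm_Spike !in_Spike lt1x ltxn /=.
rewrite !Des_fl //; try by lia.
pose t y := (y < k) || (y == k) && ~~ (absrk s y.-1 < absrk s y).
rewrite -/(t x) -/(t x.-1); set B := (X in _ = _ (+) X).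
have -> : B = t x (+) t x.-1.
  rewrite /B /t {t B}; case: x lt1x ltxn => // x lt1x ltxn /=; rewrite eqSS.
  case: (ltngtP x.+1 k) => [lt_xk|lt_kx|<-]; last first.
  - by rewrite (ltn_eqF (ltnSn x)) /=; case: (_ < _).
  - by case: eqP => [->|_] /=; case: (_ < _).
  - by rewrite (ltn_eqF (ltnW lt_xk)).
by case: (x \in Des s) (x.-1 \in Des s) (t x) (t x.-1) => [] [] [] [].
Qed.

(** The flip of length [i] removes the spike iff |e_(i-1)| < |e_i|, that of length [i.-1] iff
    |e_(i-2)| > |e_(i-1)|; both fail exactly at a peak of |e|. *)
Lemma admits_flipE n (s : 'S_n) i : i \in perm_Spike s ->
  ~~ admits_flip i s = (i \in absrk_pk s).
Proof.
move=> iS; have := iS; rewrite {1}/perm_Spike in_Spike => /and3P[lt1i ltin _].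
have flE k : k <= n -> i.-1 <= k <= i ->
    (perm_Spike (fl k s) == perm_Spike s `\ i) =
    ((i == k) && (absrk s k.-1 < absrk s k) || (i == k.+1) && ~~ (absrk s k.-1 < absrk s k)).
  move=> le_kn bnd_k; apply/eqP/idP => [eqS|flk].
    have := in_perm_Spike_fl s le_kn (x := i); rewrite eqS in_fsetD1 eqxx iS lt1i ltin => /(_ isT).
    by case: (_ || _).
  apply/fsetP => x; case: (boolP (1 < x < n)) => [bx|nbx]; last first.
    have notS (u : 'S_n) : x \in perm_Spike u = false by rewrite in_Spike andbA (negbTE nbx).
    by rewrite in_fsetD1 !notS andbF.
  rewrite in_perm_Spike_fl // in_fsetD1; case: (eqVneq x i) => [->|nxi] /=; first by rewrite flk iS.
  rewrite (_ : _ || _ = false) ?addbF //.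
  by move: flk bnd_k nxi; case: (_ < absrk s k); lia.
rewrite /admits_flip /admits_plus_flip /admits_minus_flip !flE; try by lia.
rewrite in_pk lt1i ltin /=; case: i lt1i {iS ltin flE} => [|[|i]] //= _.
have := @absrk_neq n s i; have := @absrk_neq n s i.+1; lia.
Qed.

Definition unflippable n (I : {fset nat}) : {set 'S_n} :=
  [set s in D (S_ I) n | [forall i : I, ~~ admits_flip (val i) s]].

(** For descent set [S_ I], unflippability means that [absrk_pk s] contains [I], while the expansion
    keeps only [absrk_pk s] inside [I]. This leaves equality, which is as frequent as peak set
    [I]. *)
Lemma card_unflippable n I : 0 < n -> (forall x, x \in I -> 1 < x < n) ->
  2 ^ n * #|unflippable n I| = 2 ^ (#|` I|).+1 * #|P I n|.
Proof.
move=> n_gt0 bndI.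
(* Inversion needs the expansions for all subsets [J] of [I], each being the spike set of its own
   [S_ J]. *)
have SJ J : J `<=` I -> (forall i, i \in S_ J -> 0 < i < n) /\ Spike n (S_ J) = J.
  move=> /fsubsetP sub; have bndJ x : x \in J -> 1 < x < n by move/sub/bndI.
  split=> [i|]; last exact: Spike_S_.
  by apply: S_lt => x /bndJ; lia.
have eqPV : #|[set s : 'S_n | absrk_pk s == I]| = #|P I n|.
  apply: (eq_card_of_eq_fsubset_sums (w := fun K => 2 ^ (#|` K|).+1)) => [K|J].
    by rewrite expn_gt0.
  move=> /SJ[bndS SpJ]; have := card_Des_absrk_pk predT n_gt0 bndS.
  have := card_Des_Peak n_gt0 bndS; rewrite SpJ => <- <-; congr (_ * _).
  by apply: eq_card => s; rewrite !inE andbT.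
have [bndS SpI] := SJ I (fsubset_refl I).
have -> : unflippable n I = [set s : 'S_n | (Des s == S_ I) && (I `<=` absrk_pk s)].
  apply/setP => s; rewrite !inE; case: eqP => //= DesS.
  have SpS : perm_Spike s = I by rewrite /perm_Spike DesS.
  apply/forallP/fsubsetP => [nfl i iI|sub i].
    by rewrite -admits_flipE ?SpS //; apply: nfl [` iI].
  by rewrite admits_flipE ?sub ?SpS ?(valP i).
rewrite (card_Des_absrk_pk (fun V => I `<=` V)) // SpI -eqPV card_set_sum big_distrr /=.
rewrite big_mkcond; apply: eq_bigr => s _; rewrite eqEfsubset.
case: (boolP (I `<=` absrk_pk s)) => [le1|_]; last by rewrite andbF muln0.
case: (boolP (absrk_pk s `<=` I)) => [le2|_]; last by rewrite muln0.
rewrite muln1; have /eqP-> // : absrk_pk s == I by rewrite eqEfsubset le1 le2.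
Qed.

Lemma p_unflippable n I : 0 < n -> (forall x, x \in I -> 1 < x < n) ->
  p I n = (#|unflippable n I|%:R)%R.
Proof.
move=> n_gt0 /(card_unflippable n_gt0) /(congr1 (fun k => k%:R : rat)%R).
rewrite /p !GRing.natrM !GRing.natrX => eqN.
have nz : (2%:R ^+ n != 0 :> rat)%R by rewrite GRing.expf_neq0.
apply: (GRing.mulfI nz); rewrite eqN GRing.mulrA; congr (_ * _)%R.
rewrite -[(2%:R ^+ n)%R]/((2%:R : rat) ^ n%:Z)%R -expfzDr //.
by rewrite !GRing.addrA GRing.subrr GRing.add0r -PoszD addn1.
Qed.

(** * Permutations increasing after a position *)

Section Prefix.
Variables (m n : nat).
Hypothesis lt_mn : m < n.
Implicit Type s : 'S_n.

Let w : 'I_m -> 'I_n := widen_ord (ltnW lt_mn).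

(** Read in ['I_m], so that low parts for different [n] can be compared. *)
Definition low (A : {set 'I_n}) : {set 'I_m} := [set i | w i \in A].

Definition high : {set 'I_n} := [set a : 'I_n | m <= a].

Definition prefix_set (s : 'S_n) : {set 'I_n} := [set s j | j : 'I_n & j < m].

(** Descents are numbered from 1: the letters at 0-based positions from [m] on increase, while the
    comparison across the border is left free. *)
Definition ascending_after (s : 'S_n) : bool :=
  [forall a : 'I_n, (m < a) ==> (val a \notin Des s)].

Lemma w_inj : injective w.
Proof. by move=> i j /(congr1 val) /= /val_inj. Qed.

Lemma in_prefix_set s j : (s j \in prefix_set s) = (j < m).
Proof. by rewrite mem_imset ?inE //; apply: perm_inj. Qed.

Lemma card_prefix_set s : #|prefix_set s| = m.
Proof.
by rewrite -[RHS](size_prefix_values s (ltnW lt_mn)) /prefix_values -cardE.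
Qed.

Lemma ascending_afterP s : reflect
  (forall j k : 'I_n, m <= j -> j < k -> s j < s k) (ascending_after s).
Proof.
apply: (iffP forallP) => [asc j k le_mj lt_jk|asc a]; last first.
  apply/implyP => lt_ma; rewrite in_Des !negb_and; apply/or3P/Or33.
  have lt_a1 : a.-1 < n by have := ltn_ord a; lia.
  rewrite letterE -[X in letter s X]prednK; last exact: leq_ltn_trans lt_ma.
  rewrite (letterE s (Ordinal lt_a1)) -leqNgt ltnS ltnW // asc //=; lia.
have step a : m < a -> a < n -> letter s a < letter s a.+1.
  move=> lt_ma lt_an; have := asc (Ordinal lt_an); rewrite lt_ma /= in_Des lt_an.
  rewrite (leq_ltn_trans _ lt_ma) //= -leqNgt leq_eqVlt => /orP[/eqP|//].
  by case: a lt_ma lt_an => // a _ lt_an /letter_inj; lia.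
have chain d : j.+1 + d < n -> letter s j.+1 < letter s (j.+1 + d).+1.
  elim: d => [|d IHd] lt_d; first by rewrite addn0; apply: step; lia.
  rewrite addnS in lt_d *; apply: ltn_trans (IHd (ltnW lt_d)) (step _ _ lt_d).
  by rewrite ltnS (leq_trans le_mj) // addSnnS leq_addr.
have := chain (k - j.+1); rewrite subnKC // !letterE ltnS; exact.
Qed.

(** Rebuilds a permutation increasing after [m] from its prefix set and prefix pattern. The default
    [j] is never reached once [A] has [m] elements. *)
Definition glue_fun (A : {set 'I_n}) (q : 'S_m) (j : 'I_n) : 'I_n :=
  if insub (val j) is Some i then nth j (enum A) (q i) else nth j (enum (~: A)) (j - m).

Section Glue.
Variable A : {set 'I_n}.
Hypothesis cardA : #|A| = m.
Implicit Type q : 'S_m.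

Lemma glue_lt q (j : 'I_n) (i : 'I_m) : val j = val i ->
  glue_fun A q j = nth j (enum A) (q i).
Proof. by move=> eq_ji; rewrite /glue_fun eq_ji valK. Qed.

Lemma glue_ge q (j : 'I_n) : m <= j -> glue_fun A q j = nth j (enum (~: A)) (j - m).
Proof. by move=> le_mj; rewrite /glue_fun insubF // ltnNge le_mj. Qed.

Lemma cardCA : #|~: A| = n - m.
Proof. by have := cardsC A; rewrite cardA card_ord; lia. Qed.

Lemma glue_mem q j : (glue_fun A q j \in A) = (j < m).
Proof.
case: (ltnP j m) => [lt_jm|le_mj].
  by rewrite (glue_lt q (i := Ordinal lt_jm)) // -mem_enum mem_nth // -cardE cardA.
rewrite glue_ge //; apply/negbTE; rewrite -in_setC -mem_enum mem_nth // -cardE cardCA.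
by have := ltn_ord j; lia.
Qed.

Lemma glue_inj q : injective (glue_fun A q).
Proof.
move=> j k eq_jk; apply: val_inj; have := glue_mem q j; rewrite eq_jk glue_mem.
case: (ltnP j m) => [lt_jm lt_km|le_mj /negbT]; last rewrite -leqNgt => le_mk.
  move/eqP: eq_jk; rewrite (glue_lt q (i := Ordinal lt_jm)) // (glue_lt q (i := Ordinal lt_km)) //.
  rewrite (set_nth_default k j) -?cardE ?cardA //.
  by rewrite nth_uniq ?enum_uniq -?cardE ?cardA // => /eqP/val_inj/perm_inj[].
have lt_j : j - m < #|~: A| by rewrite cardCA; have := ltn_ord j; lia.
have lt_k : k - m < #|~: A| by rewrite cardCA; have := ltn_ord k; lia.
move/eqP: eq_jk; rewrite !glue_ge // (set_nth_default k j) -?cardE //.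
rewrite nth_uniq ?enum_uniq -?cardE // => /eqP eq_sub.
by rewrite -[LHS](subnK le_mj) eq_sub subnK.
Qed.

Definition glue q : 'S_n := perm (@glue_inj q).

Lemma glueE q j : glue q j = glue_fun A q j.
Proof. exact: permE. Qed.

Lemma glue_prefix_set q : prefix_set (glue q) = A.
Proof.
apply/setP => x; rewrite -(permKV (glue q) x) in_prefix_set.
by rewrite glueE glue_mem.
Qed.

Lemma glue_ascending q : ascending_after (glue q).
Proof.
apply/ascending_afterP => j k le_mj lt_jk.
rewrite !glueE !glue_ge //; last by lia.
by rewrite enum_nth_ltn ?cardCA; have := ltn_ord k; lia.
Qed.

Lemma rk_glue q j : j < m -> rk (glue q) j = rk q j.
Proof.
move=> lt_jm; rewrite /rk [LHS]big_nat [RHS]big_nat; apply: eq_bigr => k /= lt_kj.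
have lt_km : k < m by lia.
have lE i (lt_im : i < m) : letter (glue q) i.+1 =
    (nth (w (Ordinal lt_im)) (enum A) (q (Ordinal lt_im))).+1.
  by rewrite -[i]/(val (w (Ordinal lt_im))) letterE glueE (glue_lt q (i := Ordinal lt_im)).
rewrite !lE !ltnS enum_nth_ltn ?cardA //.
by rewrite -[k]/(val (Ordinal lt_km)) -[j]/(val (Ordinal lt_jm)) !letterE.
Qed.

Lemma glue_injective : injective glue.
Proof.
move=> q q' eq_q; apply/permP => i; apply: val_inj.
have := congr1 (fun t : 'S_n => t (w i)) eq_q; rewrite !glueE !(glue_lt _ (i := i)) //.
by move/eqP; rewrite nth_uniq ?enum_uniq -?cardE ?cardA // => /eqP.
Qed.

(** The pattern records the index of each prefix letter in the enumeration of [A]. *)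
Lemma glue_onto s : ascending_after s -> prefix_set s = A -> exists q, s = glue q.
Proof.
move=> /ascending_afterP asc preA.
have sA j : (s j \in A) = (j < m) by rewrite -preA in_prefix_set.
have lt_ind (i : 'I_m) : index (s (w i)) (enum A) < m.
  by rewrite -[ltnRHS]cardA cardE index_mem mem_enum sA /=.
have inj_q : injective (fun i => Ordinal (lt_ind i)).
  move=> i i' /(congr1 val) /= eq_i; apply/w_inj/(@perm_inj _ s).
  rewrite -(nth_index (s (w i)) (s := enum A) (x := s (w i))) ?mem_enum ?sA /= //.
  by rewrite eq_i nth_index // mem_enum sA /=.
exists (perm inj_q); apply/permP => j; rewrite glueE.
case: (ltnP j m) => [lt_jm|le_mj].
  rewrite (glue_lt _ (i := Ordinal lt_jm)) // permE /=.
  have -> : w (Ordinal lt_jm) = j by apply: val_inj.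
  by rewrite nth_index // mem_enum sA.
rewrite glue_ge //.
have nth_s k (lt_kn : k < n) : nth j [seq s i | i <- enum 'I_n] k = s (Ordinal lt_kn).
  rewrite (nth_map j) ?size_enum_ord //; congr (s _).
  exact: (nth_ord_enum j (Ordinal lt_kn)).
(* Both lists are strictly increasing with the same elements. *)
have -> : enum (~: A) = drop m [seq s k | k <- enum 'I_n].
  apply: (irr_sorted_eq (leT := fun a b : 'I_n => a < b)).
  - by move=> a b c; apply: ltn_trans.
  - by move=> a; rewrite /= ltnn.
  - exact: enum_sorted_ltn.
  - apply/(sortedP j) => k; rewrite size_drop size_map size_enum_ord => lt_k.
    have lt1 : m + k < n by lia. have lt2 : m + k.+1 < n by lia.
    by rewrite !nth_drop !(nth_s _ lt1, nth_s _ lt2) asc //= ?leq_addr ?ltn_add2l.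
  move=> x; rewrite mem_enum in_setC -(permKV s x) sA -leqNgt.
  set y := (s^-1)%g x.
  apply/idP/(nthP j) => [le_my|[k]].
    exists (y - m); first by rewrite size_drop size_map size_enum_ord; have := ltn_ord y; lia.
    by rewrite nth_drop subnKC // (nth_map j) ?size_enum_ord // nth_ord_enum.
  rewrite size_drop size_map size_enum_ord => lt_k.
  have lt1 : m + k < n by lia.
  by rewrite nth_drop (nth_s _ lt1) => /perm_inj <-; apply: leq_addr.
by rewrite nth_drop subnKC // (nth_map j) ?size_enum_ord // nth_ord_enum.
Qed.

End Glue.
End Prefix.

(** The indices counted form an initial interval, so this is the least index missing from [B], or
    [m] if there is none. *)
Definition initial_run m (B : {set 'I_m}) : nat :=
  #|[set i : 'I_m | [forall c : 'I_m, (c <= i) ==> (c \in B)]]|.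

(** The letter after the prefix is the least value outside the prefix set, so the prefix letters
    below it form the initial run of that set. *)
Lemma rk_prefix m n (lt_mn : m < n) (s : 'S_n) : ascending_after m s ->
  rk s m = initial_run (low lt_mn (prefix_set m s)).
Proof.
move=> /(ascending_afterP lt_mn) asc; set A := prefix_set m s.
have sA j : (s j \in A) = (j < m) by rewrite in_prefix_set.
pose om := Ordinal lt_mn.
pose w : 'I_m -> 'I_n := widen_ord (ltnW lt_mn).
have runA : [set a : 'I_n | (a \in A) && (a < s om)] =
    [set a : 'I_n | [forall c : 'I_n, (c <= a) ==> (c \in A)]].
  apply/setP => a; rewrite !inE; apply/andP/forallP => [[_ lt_a] c|runa].
    apply/implyP => le_ca; rewrite -(permKV s c) sA ltnNge; apply/negP => le_m.
    have := asc om (s^-1 c)%g (leqnn _); rewrite permKV leq_eqVlt in le_m *.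
    case/orP: le_m => [/eqP eq_m _|lt_m /(_ lt_m)]; last by lia.
    have eq_c : s om = c by rewrite -[RHS](permKV s); congr (s _); apply: val_inj.
    by move: le_ca; rewrite -eq_c leqNgt lt_a.
  split; first by have := runa a; rewrite leqnn.
  rewrite ltnNge; apply/negP => le_sa; have := runa (s om).
  by rewrite le_sa sA ltnn.
have rkE : rk s m = #|[set a : 'I_n | (a \in A) && (a < s om)]|.
  rewrite -sum1_card /rk big_mkord.
  rewrite (eq_bigl (fun a => (a \in A) && (a < s om))); last by move=> a; rewrite inE.
  rewrite big_mkcondr /A /prefix_set big_imset; last by move=> ? ? _ _; apply: perm_inj.
  rewrite (big_ord_widen n (fun k => letter s k.+1 < letter s m.+1 : nat) (ltnW lt_mn)).
  apply: eq_big => [k|k _]; rewrite ?inE // -[m]/(val om) !letterE ltnS.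
  by case: (_ < _).
rewrite rkE runA /initial_run -(card_imset _ (f := w)); last first.
  by move=> i j /(congr1 val) /= /val_inj.
congr #|pred_of_set _|; apply/setP => a; rewrite inE.
apply/forallP/imsetP => [runa|[i]].
  (* A run through [a] has [a.+1] elements, all in the prefix set of size [m]. *)
  have lt_am : a < m.
    rewrite -(card_prefix_set lt_mn s) -/A -[ltnLHS]/(a.+1.-1).
    have : #|[set c : 'I_n | c < a.+1]| <= #|A|.
      by apply: subset_leq_card; apply/subsetP => c; rewrite inE ltnS; apply/implyP/runa.
    have lt_an := ltn_ord a.
    by rewrite -sum1_card (eq_bigl (fun c : 'I_n => c < a.+1)) => [|c]; rewrite ?inE // (big_ord_narrow lt_an) sum1_card card_ord.
  exists (Ordinal lt_am); last exact: val_inj.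
  rewrite inE; apply/forallP => c; rewrite inE; exact: (runa (w c)).
rewrite inE => /forallP runi -> c; apply/implyP => /= le_ci.
have lt_cm : c < m by apply: leq_ltn_trans le_ci (ltn_ord i).
have := runi (Ordinal lt_cm); rewrite /= le_ci inE.
by congr (_ \in A); apply: val_inj.
Qed.

(* [r] is meant to be [rk s], of which only the values up to [m] are read. *)
Definition unflippable_rks (m : nat) (I : {fset nat}) (r : nat -> nat) : bool :=
  let absr j := (2 * r j - j) + (j - 2 * r j) in
  [forall a : 'I_m.+1, (0 < a) ==> ((r a <= r a.-1) == (val a \in S_ I))] &&
  [forall i : I, (absr (val i).-2 < absr (val i).-1) && (absr (val i) < absr (val i).-1)].

Lemma eq_unflippable_rks m I r r' : (forall x : nat, x \in I -> 1 < x <= m) ->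
  (forall j, j <= m -> r j = r' j) ->
  unflippable_rks m I r = unflippable_rks m I r'.
Proof.
move=> bndI eq_r; rewrite /unflippable_rks; congr (_ && _); apply: eq_forallb => i.
  by rewrite !eq_r //; have := ltn_ord i; lia.
have /andP[_ le_im] := bndI _ (valP i); have le1 := leq_trans (leq_pred _) le_im.
by rewrite !eq_r // (leq_trans (leq_pred _)).
Qed.

(** Since [S_ I] lies below [m], later positions must ascend; all other conditions involve ranks up
    to index [m] only. *)
Lemma in_unflippable m n I (s : 'S_n) : m < n -> (forall x : nat, x \in I -> 1 < x <= m) ->
  (s \in unflippable n I) = ascending_after m s && unflippable_rks m I (rk s).
Proof.
move=> lt_mn bndI; rewrite !inE; have ltS a : a \in S_ I -> 0 < a < m by apply: S_lt.
rewrite Des_eqE => [|a /ltS]; last by lia.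
have -> : [forall a : 'I_n, (0 < a) ==> ((val a \in Des s) == (val a \in S_ I))] =
  ascending_after m s && [forall a : 'I_m.+1, (0 < a) ==> ((rk s a <= rk s a.-1) == (val a \in S_ I))].
  apply/forallP/andP => [eqS|[/forallP asc /forallP eqS] a].
    split; apply/forallP => a; apply/implyP.
      move=> lt_ma; have := eqS a; rewrite (leq_ltn_trans _ lt_ma) //= => /eqP->.
      by apply/negP => /ltS; lia.
    have lt_an : a < n by have := ltn_ord a; lia.
    move=> a_gt0; have := eqS (Ordinal lt_an); rewrite /= a_gt0 /= => /eqP <-.
    by rewrite -(prednK a_gt0) rk_Des // prednK.
  apply/implyP => a_gt0; case: (ltnP m a) => [lt_ma|le_am].
    have := asc a; rewrite lt_ma /= => /negbTE->.
    by rewrite eq_sym; apply/eqP/negP => /ltS; lia.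
  have := eqS (Ordinal (le_am : a < m.+1)); rewrite /= a_gt0 /= => /eqP <-.
  by rewrite -(prednK a_gt0) rk_Des // prednK.
rewrite -andbA; case: (boolP (ascending_after m s)) => //= _.
rewrite /unflippable_rks /=; case: (boolP [forall a : 'I_m.+1, _]) => //= /forallP eqS.
have DesS a : 0 < a <= m -> (a \in Des s) = (a \in S_ I).
  case/andP=> a_gt0 le_am; have := eqS (Ordinal (le_am : a < m.+1)); rewrite /= a_gt0 /= => /eqP <-.
  by rewrite -(prednK a_gt0) rk_Des // prednK //; apply: leq_ltn_trans lt_mn.
apply: eq_forallb => i; have := bndI _ (valP i) => /andP[gt1 le_im].
rewrite admits_flipE; last first.
  have := valP i; rewrite -[X in _ \in X -> _](@Spike_S_ I n) => [|x /bndI /andP[-> /leq_ltn_trans->]] //.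
  have [le1 gt0] : (val i).-1 <= m /\ 0 < (val i).-1.
    by rewrite (leq_trans (leq_pred _) le_im) -subn1 subn_gt0.
  by rewrite /perm_Spike !in_Spike !DesS ?gt0 ?le1 ?le_im ?(ltnW gt1).
by rewrite in_pk gt1 (leq_ltn_trans le_im lt_mn).
Qed.

(** * Counting by the low and high values of the prefix *)

(** [c] stands for the rank of the first letter after the prefix, which [q] does not determine. *)
Definition patterns m (I : {fset nat}) (c : nat) : {set 'S_m} :=
  [set q : 'S_m | unflippable_rks m I (fun j => if j < m then rk q j else c)].

(** Gluing is a bijection from patterns to the fiber, and [A] enters the rank conditions only
    through its initial run. *)
Lemma card_unflippable_fiber m n (lt_mn : m < n) (I : {fset nat}) (A : {set 'I_n}) :
  (forall x : nat, x \in I -> 1 < x <= m) -> #|A| = m ->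
  #|[set s in unflippable n I | prefix_set m s == A]| =
  #|patterns m I (initial_run (low lt_mn A))|.
Proof.
move=> bndI cardA; rewrite -(card_imset _ (@glue_injective _ _ lt_mn _ cardA)).
have rkE s : ascending_after m s -> prefix_set m s = A -> forall q,
    (forall j, j < m -> rk s j = rk q j) ->
    (q \in patterns m I (initial_run (low lt_mn A))) = unflippable_rks m I (rk s).
  move=> asc preA q eq_rk; rewrite inE; apply: eq_unflippable_rks => // j.
  rewrite leq_eqVlt => /orP[/eqP->|lt_jm]; last by rewrite lt_jm eq_rk.
  by rewrite ltnn (rk_prefix lt_mn) // preA.
congr #|pred_of_set _|; apply/setP => s; rewrite inE (in_unflippable _ lt_mn) //.
apply/andP/imsetP => [[/andP[asc good] /eqP preA]|[q pat_q ->]].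
  have [q def_s] := glue_onto lt_mn cardA asc preA; exists q => //.
  by rewrite (rkE s) // => j lt_jm; rewrite def_s rk_glue.
have asc := glue_ascending lt_mn cardA q.
have preA := glue_prefix_set lt_mn cardA q.
split; last exact/eqP.
by rewrite asc -(rkE _ asc preA q) // => j lt_jm; rewrite rk_glue.
Qed.

(** With low part [B] fixed, [A] is determined by its high part, which has the remaining [m - #|B|]
    elements. *)
Lemma card_low_high m n (lt_mn : m < n) (B : {set 'I_m}) (Q : pred {set 'I_n}) :
  #|[set A : {set 'I_n} | [&& #|A| == m, low lt_mn A == B & Q (A :&: high m n)]]| =
  #|[set U : {set 'I_n} | [&& U \subset high m n, #|U| == m - #|B| & Q U]]|.
Proof.
pose w : 'I_m -> 'I_n := widen_ord (ltnW lt_mn).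
have injw : injective w by move=> i j /(congr1 val) /= /val_inj.
have splitA (A : {set 'I_n}) : A = w @: low lt_mn A :|: A :&: high m n.
  apply/setP => a; rewrite !inE; case: (ltnP a m) => [lt_am|le_ma].
    rewrite andbF orbF; have -> : a = w (Ordinal lt_am) by apply: val_inj.
    by rewrite mem_imset // inE.
  rewrite andbT; case: (a \in A); rewrite ?orbT // orbF; apply/esym/imsetP => -[i _ eq_a].
  by have := ltn_ord i; rewrite eq_a /= in le_ma; lia.
have disj (C : {set 'I_m}) (U : {set 'I_n}) : U \subset high m n -> [disjoint w @: C & U]%B.
  move=> /subsetP sub; apply/pred0P => a /=; apply/negP => /andP[/imsetP[i _ ->]] /sub.
  by rewrite inE /= leqNgt ltn_ord.
have lowU (U : {set 'I_n}) : U \subset high m n -> low lt_mn (w @: B :|: U) = B.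
  move=> sub; apply/setP => i; rewrite !inE -/(w i) mem_imset //.
  case: (boolP (w i \in U)) => [/(subsetP sub)|]; last by rewrite orbF.
  by rewrite inE /= leqNgt ltn_ord.
have highU (U : {set 'I_n}) : U \subset high m n -> (w @: B :|: U) :&: high m n = U.
  move=> sub; rewrite setIUl (setIidPl sub); have := disj B _ (subxx (high m n)).
  by rewrite -setI_eq0 => /eqP->; rewrite set0U.
have leB : #|B| <= m by rewrite -[leqRHS]card_ord max_card.
rewrite -[RHS](card_in_imset (f := fun U => w @: B :|: U)); last first.
  move=> U U'; rewrite !inE => /andP[sub _] /andP[sub' _] eqU.
  by rewrite -(highU U sub) -(highU U' sub') eqU.
congr #|pred_of_set _|; apply/setP => A; rewrite inE; apply/and3P/imsetP.
  move=> [/eqP cardA /eqP lowA QA]; exists (A :&: high m n); last by rewrite -lowA -splitA.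
  rewrite inE subsetIr QA andbT /=; apply/eqP.
  have := leq_card_setU (w @: B) (A :&: high m n).
  rewrite disj ?subsetIr // => /leqifP /eqP.
  by rewrite card_imset // -lowA -splitA cardA => /(congr1 (subn^~ #|low lt_mn A|)) ->; rewrite addKn.
case=> U; rewrite inE => /and3P[sub /eqP cardU QU] ->.
rewrite lowU // highU // eqxx QU; split=> //.
have := leq_card_setU (w @: B) U; rewrite disj // => /leqifP /eqP ->.
by rewrite card_imset // cardU subnKC.
Qed.

(** Grouping by prefix set, then by its low part [B]. It is applied in size [n] with no condition on
    the high part, and in size [2 * m] with the high part prescribed as in [b]. *)
Lemma card_unflippable_prefix m n (I : {fset nat}) (Q : pred {set 'I_n}) :
  m < n -> (forall x : nat, x \in I -> 1 < x <= m) ->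
  #|[set s in unflippable n I | Q (prefix_set m s :&: high m n)]| =
  \sum_(B : {set 'I_m})
     #|[set U : {set 'I_n} | [&& U \subset high m n, #|U| == m - #|B| & Q U]]| *
     #|patterns m I (initial_run B)|.
Proof.
move=> lt_mn bndI.
under eq_bigr => B _ do rewrite -(card_low_high lt_mn) -sum_nat_const.
rewrite (exchange_big_dep (fun A : {set 'I_n} => (#|A| == m) && Q (A :&: high m n))) /=; last first.
  by move=> B A _; rewrite inE => /and3P[-> _ ->].
rewrite -sum1_card (partition_big (@prefix_set m n) (fun A : {set 'I_n} => (#|A| == m) && Q (A :&: high m n))) /=; last first.
  by move=> s; rewrite inE => /andP[_ ->]; rewrite card_prefix_set // eqxx.
apply: eq_bigr => A /andP[/eqP cardA QA].
rewrite (big_pred1 (low lt_mn A)); last first.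
  by move=> B; rewrite inE cardA eqxx QA andbT /= eq_sym.
rewrite -card_unflippable_fiber // -sum1_card; apply: eq_bigl => s; rewrite [in RHS]in_set [in LHS]in_set.
by case: (prefix_set m s =P A) => [->|_]; rewrite ?andbF // QA !andbT.
Qed.

Lemma card_high m n : m < n -> #|high m n| = n - m.
Proof.
move=> lt_mn; have := cardsC (high m n); rewrite card_ord => eq_n.
have : #|~: high m n| = m; last by lia.
rewrite -sum1_card (eq_bigl (fun c : 'I_n => c < m)) => [|c]; last by rewrite !inE -ltnNge.
by rewrite (big_ord_narrow (ltnW lt_mn)) sum1_card card_ord.
Qed.

(** Letters are values plus one, so [m+1, m+k] becomes [m <= a < m + k]. *)
Lemma b_prefix m (I : {fset nat}) k : 1 <= m -> k <= m ->
  b m I k = #|[set s in unflippable (2 * m) I |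
    prefix_set m s :&: high m (2 * m) == [set a : 'I_(2 * m) | m <= a < m + k]]|.
Proof.
move=> m_gt0 le_km; congr #|pred_of_set _|; apply/setP => s.
rewrite /unflippable [in LHS]in_set [in RHS]in_set [X in _ = X && _]in_set.
rewrite -[RHS]andbA; congr (_ && _); rewrite [RHS]andbC; congr (_ && _).
have letA (a : 'I_(2 * m)) :
    (a.+1 \in [fset letter s j | j in intv 1 m]) = (a \in prefix_set m s).
  apply/imfsetP/imsetP => [[j]|[j]].
    rewrite /= in_intv => /andP[j_gt0 le_jm].
    have lt_j : j.-1 < 2 * m by lia.
    rewrite -(prednK j_gt0) (letterE s (Ordinal lt_j)) => -[/val_inj ->].
    by exists (Ordinal lt_j); rewrite // inE /= prednK.
  by rewrite inE => lt_jm ->; exists j.+1; rewrite ?letterE //= in_intv.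
apply/eqP/eqP => [/fsetP eqI|/setP eqI].
  apply/setP => a; have := eqI a.+1.
  by rewrite in_fsetI letA !in_intv !inE !ltnS ltn_ord andbT => ->.
apply/fsetP => -[|a]; first by rewrite in_fsetI !in_intv andbF.
rewrite in_fsetI !in_intv !ltnS; case: (ltnP a (2 * m)) => [lt_a|le_a].
  rewrite (letA (Ordinal lt_a)); have := eqI (Ordinal lt_a).
  by rewrite !inE /= andbT => ->.
by rewrite !andbF; apply/esym/negP => /andP[_]; lia.
Qed.

(** Both sides are sums over [B] with the same pattern counts; on the left, [m - #|B|] high values
    are chosen freely among [n - m]. *)
Lemma card_unflippable_binomial m n (I : {fset nat}) :
  1 <= m -> m < n -> (forall x : nat, x \in I -> 1 < x <= m) ->
  #|unflippable n I| = \sum_(0 <= k < m.+1) b m I k * 'C(n - m, k).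
Proof.
move=> m_gt0 lt_mn bndI.
have lt_m2 : m < 2 * m by lia.
have -> : #|unflippable n I| = #|[set s in unflippable n I | xpredT (prefix_set m s :&: high m n)]|.
  by apply: eq_card => s; rewrite [in RHS]in_set andbT.
rewrite (@card_unflippable_prefix m n I xpredT) //.
under [RHS]eq_big_nat => k lt_k.
  rewrite b_prefix // (@card_unflippable_prefix m (2 * m) I (fun U => U == [set a : 'I_(2 * m) | m <= a < m + k])) //.
  rewrite big_distrl /=; over.
rewrite exchange_big /=; apply: eq_bigr => B _.
have leB : m - #|B| < m.+1 by lia.
(* The prescribed high part has [k] elements, so [B] contributes to [b m I k] only for
   [k = m - #|B|], with a single choice of [U]. *)
have cardU k : k <= m ->
    #|[set U : {set 'I_(2 * m)} | [&& U \subset high m (2 * m), #|U| == m - #|B|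
        & U == [set a : 'I_(2 * m) | m <= a < m + k]]]| = (m - #|B| == k).
  move=> le_k; set H := [set a : 'I_(2 * m) | _].
  have cardH : #|H| = k.
    have lt_k2 : m + k <= 2 * m by lia.
    have := cardsID [set a : 'I_(2 * m) | a < m] [set a : 'I_(2 * m) | a < m + k].
    have cardlt j : j <= 2 * m -> #|[set a : 'I_(2 * m) | a < j]| = j.
      move=> le_j; rewrite -sum1_card (eq_bigl (fun c : 'I_(2 * m) => c < j)) => [|c]; last by rewrite inE.
      by rewrite (big_ord_narrow le_j) sum1_card card_ord.
    rewrite cardlt // (_ : _ :\: _ = H); last by apply/setP => a; rewrite !inE -leqNgt.
    rewrite (setIidPr _) ?cardlt ?(ltnW lt_m2) //; first by lia.
    by apply/subsetP => a; rewrite !inE => /ltn_addr->.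
  have subH : H \subset high m (2 * m) by apply/subsetP => a; rewrite !inE => /andP[].
  rewrite -cardH eq_sym; case: (eqVneq #|H| (m - #|B|)) => eqH.
    transitivity #|[set H]|; last by rewrite cards1.
    apply: eq_card => U; rewrite !inE.
    by case: (U =P H) => [->|_]; rewrite ?andbF // subH eqH eqxx.
  apply/eqP; rewrite cards_eq0; apply/eqP/setP => U; rewrite !inE.
  by case: (U =P H) => [->|_]; rewrite ?andbF // (negbTE eqH) andbF.
rewrite (eq_big_nat _ _ (F2 := fun k => if k == m - #|B| then
  #|patterns m I (initial_run B)| * 'C(n - m, m - #|B|) else 0)); last first.
  move=> k /andP[_ le_k]; rewrite cardU // eq_sym; case: eqP => [->|_]; by rewrite ?mul1n ?mul0n.
rewrite -big_mkcond /= big_nat1_eq leq0n leB /= mulnC; congr (_ * _).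
rewrite -(card_high lt_mn) -cards_draws; apply: eq_card => U; by rewrite !inE andbT.
Qed.

Theorem mainTheorem1 (I : {fset nat}) (m n : nat)
    (adm_I : admissible I) (m_ge1 : 1 <= m)
    (max_I : \max_(i <- enum_fset I) i <= m) (lt_mn : m < n) :
  p I n = (\sum_(0 <= k < m.+1) (b m I k)%:R * 'C(n - m, k)%:R)%R.
Proof.
have bndI (x : nat) : x \in I -> 1 < x <= m.
  by move=> xI; rewrite adm_I.1 // (leq_trans _ max_I) // (@leq_bigmax_seq _ _ xpredT id).
rewrite p_unflippable ?(leq_trans _ lt_mn) // => [|x /bndI /andP[-> /leq_ltn_trans->]] //.
rewrite (card_unflippable_binomial m_ge1 lt_mn) // GRing.natr_sum.
by apply: eq_bigr => k _; rewrite GRing.natrM.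
Qed.
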